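(* Let $I$ be a compact Hausdorff space and $f_i:\mathbb{R}^m\to\mathbb{R}$, $i\in I$, convex functions such that $i\mapsto f_i(x)$ is continuous on $I$ for each $x$; set $F(i,x):=f_i(x)$, $f(x):=\max_{i\in I}f_i(x)$, $I_f(x):=\{i\in I: f_i(x)=f(x)\}$ and $S_f:=\{x: f(x)\le0\}$. Then the following are equivalent: (i) there exists $\tau\in(0,+\infty)$ such that $\inf\left\{\left|\min_{\|h\|=1}f'(\bar x,h)\right|:\bar x\in\mathrm{bdry}(S_f)\right\}>\tau$ and the following qualification condition (QC) holds: for any sequence $\{z_k\}\subseteq S_f\setminus\mathrm{bdry}(S_f)$ for which there is a sequence $\{x_k\}\subseteq\mathrm{bdry}(S_f)$ with $\lim_{k\to\infty}\frac{f(z_k)-f(x_k)}{\|z_k-x_k\|}=0$, one has $\liminf_{k\to\infty}\left|\min_{\|h\|=1}f'(z_k,h)\right|>\tau$; (ii) there exist constants $c,\varepsilon>0$ such that whenever $G\in C(I\times\mathbb{R}^m,\mathbb{R})$ is such that each $g_i:=G(i,\cdot)$ is convex, and, with $g(x):=\max_{i\in I}g_i(x)$ and $I_g(x):=\{i\in I:g_i(x)=g(x)\}$, one has: $\{z\in\mathrm{bdry}(S_f): f_i(z)=g_i(z)\ \forall i\in I\}\neq\emptyset$; $\sup_{i\in I}\mathrm{Lip}(f_i-g_i)<\varepsilon$; for every $x\in\mathbb{R}^m$, $I_g(x)\subseteq I_f(x)$ whenever $\min_{\|h\|=1}f'(x,h)<0$, and $I_f(x)\subseteq I_g(x)$ whenever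 $\min_{\|h\|=1}f'(x,h)>0$; then $\tau_{\min}(G)\le c$; (iii) there exist constants $c,\varepsilon>0$ such that for all $\bar x\in\mathrm{bdry}(S_f)$ and all $u^*\in\mathbb{R}^m$ with $\|u^*\|\le1$, one has $\tau_{\min}(G)\le c$, where $G\in C(I\times\mathbb{R}^m,\mathbb{R})$ is defined by $G(i,x):=f_i(x)+\varepsilon\langle u^*,x-\bar x\rangle$.
   Context: $\mathbb{R}^m$ carries the Euclidean norm, $d(x,D)=\inf\{\|x-y\|:y\in D\}$ (with $\inf\emptyset=+\infty$), $\mathrm{bdry}(D)$ is the boundary of $D$. For a convex $\varphi$, $\varphi'(x,h):=\lim_{t\to0^+}\frac{\varphi(x+th)-\varphi(x)}{t}$. $\mathrm{Lip}(\phi):=\sup_{u\neq v}\frac{|\phi(u)-\phi(v)|}{\|u-v\|}$. For $G\in C(I\times\mathbb{R}^m,\mathbb{R})$ with $g_i:=G(i,\cdot)$ convex and $g:=\max_{i\in I}g_i$, the solution set is $S_G:=\{x: g_i(x)\le0\ \forall i\in I\}$ and the global error bound modulus is $\tau_{\min}(G):=\inf\{\tau>0: d(x,S_G)\le\tau[g(x)]_+\ \forall x\in\mathbb{R}^m\}$, where $[t]_+=\max\{t,0\}$ and $\inf\emptyset=+\infty$. *)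

(* Defs.v *)
From HB Require Import structures.
From mathcomp Require Import all_boot all_order all_algebra.
From mathcomp Require Import all_classical all_reals all_analysis.
Set Implicit Arguments. Unset Strict Implicit. Unset Printing Implicit Defensive.
Import Order.TTheory GRing.Theory Num.Theory.
Import numFieldNormedType.Exports.
Local Open Scope classical_set_scope.
Local Open Scope ring_scope.

Section Defs.
Variables (R : realType) (m : nat).
Notation V := 'rV[R]_m.

Definition inner (u v : V) : R := \sum_(j < m) u 0 j * v 0 j.
Definition enorm (u : V) : R := Num.sqrt (\sum_(j < m) u 0 j ^+ 2).

(* d(x,D) = inf{||x-y|| : y in D}, with inf of the empty set = +oo *)
Definition edist (x : V) (D : set V) : \bar R :=
  ereal_inf [set (enorm (x - y))%:E | y in D].

Definition bdry (D : set V) : set V := closure D `\` interior D.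

Definition convex_fun (phi : V -> R) : Prop :=
  forall (x y : V) (t : R), 0 <= t -> t <= 1 ->
    phi (t *: x + (1 - t) *: y) <= t * phi x + (1 - t) * phi y.

Definition dirder (phi : V -> R) (x h : V) : R :=
  lim ((fun t : R => (phi (x + t *: h) - phi x) / t) @ at_right 0).

(* min_{||h||=1} phi'(x,h), written as the infimum over the Euclidean unit sphere
   (the minimum is attained for convex finite phi) *)
Definition mindir (phi : V -> R) (x : V) : R :=
  inf [set dirder phi x h | h in [set h : V | enorm h = 1]].

Definition Lip (phi : V -> R) : \bar R :=
  ereal_sup [set r | exists u v : V, u != v /\
                 r = (`|phi u - phi v| / enorm (u - v))%:E].

Variable I : Type.

Definition supfun (G : I -> V -> R) (x : V) : R := sup [set G i x | i in [set: I]].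

Definition active (G : I -> V -> R) (x : V) : set I :=
  [set i | G i x = supfun G x].

Definition solset (G : I -> V -> R) : set V := [set x | forall i, G i x <= 0].

(* global error bound modulus tau_min(G), with inf of empty set = +oo *)
Definition tau_min (G : I -> V -> R) : \bar R :=
  ereal_inf [set tau%:E | tau in [set tau : R | 0 < tau /\
     forall x : V, (edist x (solset G) <= (tau * Num.max (supfun G x) 0)%:E)%E]].
End Defs.

(* Main.v *)
(* Write a(x) for the minimum of f'(x,.) over the unit sphere, attained at h; then a(x) h is a subgradient of f at x.

(i) => (ii): by QC, if g is eps-close to f, agrees with f at some z in bdry S_f and g(x) > 0, then a(x) <= -tau. For f(x) > 0 this comes from projecting x on S_f; for f(x) <= 0 one has 0 >= f(x) >= -eps |x - z|, so |a(x)| > tau, and a(x) > tau would contradict the growth f(z) - f(x) >= a(x) |z - x|. The inclusion of active sets carries the descent direction over to g, and a uniform descent rate on {g > 0} yields an error bound (minimise y |-> [g(y)]_+ + r |y - x|).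

(ii) => (iii): a tilt common to all f_i does not change the active sets.

(iii) => (i): if |a| is too small at a point, the tilt cancelling the subgradient a h up to a small vector w confines S_g to a half-space with normal w near which g grows too slowly for the error bound. *)
Require Import Defs.
From HB Require Import structures.
From mathcomp Require Import all_boot all_order all_algebra.
From mathcomp Require Import ring lra.
From mathcomp Require Import all_classical all_reals all_analysis.
Import Order.TTheory GRing.Theory Num.Theory.
Import numFieldNormedType.Exports.
Local Open Scope classical_set_scope.
Local Open Scope ring_scope.
Set Implicit Arguments.
Unset Strict Implicit.
Unset Printing Implicit Defensive.

(** * Euclidean inner product, norm and topology of row vectors *)

Section Euclid.
Variables (R : realType) (m : nat).
Implicit Types (u v w x y h : 'rV[R]_m) (a b t : R).

Lemma innerC u v : inner u v = inner v u.
Proof. by apply: eq_bigr => j _; rewrite mulrC. Qed.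

Lemma innerDl u v w : inner (u + v) w = inner u w + inner v w.
Proof. by rewrite -big_split; apply: eq_bigr => j _; rewrite mxE mulrDl. Qed.

Lemma innerZl a u v : inner (a *: u) v = a * inner u v.
Proof. by rewrite mulr_sumr; apply: eq_bigr => j _; rewrite mxE mulrA. Qed.

Lemma innerDr u v w : inner w (u + v) = inner w u + inner w v.
Proof. by rewrite innerC innerDl !(innerC w). Qed.

Lemma innerZr a u v : inner v (a *: u) = a * inner v u.
Proof. by rewrite innerC innerZl (innerC v). Qed.

Lemma innerNl u v : inner (- u) v = - inner u v.
Proof. by rewrite -scaleN1r innerZl mulN1r. Qed.

Lemma innerNr u v : inner u (- v) = - inner u v.
Proof. by rewrite innerC innerNl innerC. Qed.

Lemma enorm_ge0 u : 0 <= enorm u.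
Proof. exact: sqrtr_ge0. Qed.

Lemma sqr_enorm u : enorm u ^+ 2 = inner u u.
Proof.
rewrite sqr_sqrtr; last by apply: sumr_ge0 => j _; exact: sqr_ge0.
by apply: eq_bigr => j _; rewrite expr2.
Qed.

Lemma sqr_enormD u v :
  enorm (u + v) ^+ 2 = enorm u ^+ 2 + 2 * inner u v + enorm v ^+ 2.
Proof. by rewrite !sqr_enorm innerDl !innerDr (innerC v u); ring. Qed.

Lemma enorm_eq0 u : (enorm u == 0) = (u == 0).
Proof.
apply/idP/eqP => [/eqP u0|->]; last first.
  by rewrite -sqrf_eq0 sqr_enorm -[0](scale0r 0) innerZl mul0r.
apply/rowP => j; rewrite mxE; apply/eqP; rewrite -sqrf_eq0.
move/eqP: u0; rewrite -sqrf_eq0 sqr_enorm psumr_eq0; last first.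
  by move=> i _; rewrite -expr2 sqr_ge0.
by move=> /allP/(_ j); rewrite mem_index_enum expr2 => /(_ isT).
Qed.

Lemma enorm_gt0 u : (0 < enorm u) = (u != 0).
Proof. by rewrite lt0r enorm_eq0 enorm_ge0 andbT. Qed.

Lemma enormZ a u : enorm (a *: u) = `|a| * enorm u.
Proof.
apply/eqP; rewrite -(eqrXn2 (n:=2)) ?mulr_ge0 ?enorm_ge0//.
by rewrite exprMn !sqr_enorm innerZl innerZr mulrA -expr2 real_normK ?num_real.
Qed.

Lemma enormN u : enorm (- u) = enorm u.
Proof. by rewrite -scaleN1r enormZ normrN1 mul1r. Qed.

Lemma enormBC u v : enorm (u - v) = enorm (v - u).
Proof. by rewrite -enormN opprB. Qed.

Lemma enorm0 : enorm (0 : 'rV[R]_m) = 0.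
Proof. by apply/eqP; rewrite enorm_eq0. Qed.

(** Expand the square of [enorm v *: u - enorm u *: v] and cancel the factor [enorm u * enorm v],
    which is positive once zero vectors are set aside. *)
Lemma inner_le_enorm u v : inner u v <= enorm u * enorm v.
Proof.
have [->|u0] := eqVneq u 0; first by rewrite -(scale0r 0) innerZl enormZ normr0 !mul0r.
have [->|v0] := eqVneq v 0; first by rewrite -(scale0r 0) innerZr enormZ normr0 !(mul0r, mulr0).
move: u0 v0; rewrite -!enorm_gt0 => u0 v0.
have := sqr_ge0 (enorm (enorm v *: u - enorm u *: v)).
rewrite sqr_enorm !(innerDl, innerDr, innerNl, innerNr, innerZl, innerZr).
rewrite (innerC v u) -!sqr_enorm => h.
by rewrite -subr_ge0 -(pmulr_rge0 _ (mulr_gt0 u0 v0)); lra.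
Qed.

Lemma normr_inner_le u v : `|inner u v| <= enorm u * enorm v.
Proof.
by rewrite ler_norml lerNl -innerNl -(enormN u) inner_le_enorm enormN inner_le_enorm.
Qed.

Lemma enormD u v : enorm (u + v) <= enorm u + enorm v.
Proof.
rewrite -ler_sqr ?nnegrE ?addr_ge0 ?enorm_ge0// sqr_enormD.
have := inner_le_enorm u v; lra.
Qed.

Lemma enorm_normalize u : u != 0 -> enorm ((enorm u)^-1 *: u) = 1.
Proof.
rewrite -enorm_gt0 => u0.
by rewrite enormZ gtr0_norm ?invr_gt0// mulVf// gt_eqF.
Qed.

Lemma coord_le_enorm u j : `|u 0 j| <= enorm u.
Proof.
rewrite -ler_sqr ?nnegrE ?enorm_ge0// real_normK ?num_real// sqr_enorm expr2.
by rewrite /inner (bigD1 j)//= lerDl sumr_ge0// => i _; rewrite -expr2 sqr_ge0.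
Qed.

Lemma continuous_enorm : continuous (@enorm R m).
Proof.
move=> x; apply: continuous_comp; last exact: sqrt_continuous.
move: x; apply: continuous_big => [|j _ x]; first exact: add_continuous.
apply: (@continuous_comp _ _ _ (fun u => u 0 j) (fun a => a ^+ 2)).
  exact: coord_continuous.
exact: exprn_continuous.
Qed.

Lemma continuous_edist x : continuous (fun y => enorm (y - x)).
Proof.
move=> y; apply: (@continuous_comp _ _ _ (fun y => y - x) (@enorm R m)).
  by apply: continuousB; [exact: cvg_id|exact: cst_continuous].
exact: continuous_enorm.
Qed.

(** Bridges the ambient sup-norm topology and Euclidean balls: coordinates are bounded by [enorm],
    and [enorm] is continuous for the ambient topology. *)
Lemma nbhs_enormP x (A : set 'rV[R]_m) :
  nbhs x A <-> exists2 r, 0 < r & forall y, enorm (y - x) < r -> A y.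
Proof.
split=> [/nbhs_ballP[r /= r0 rA]|[r r0 rA]].
  exists r => // y yx; apply: rA; split=> // i j; rewrite ord1 -ball_normE /ball_ /=.
  by rewrite distrC (le_lt_trans _ yx)//; have := coord_le_enorm (y - x) j; rewrite !mxE.
have /cvgrPdist_lt/(_ r r0) := @continuous_edist x x; rewrite subrr enorm0.
apply: filterS => y; rewrite sub0r normrN ger0_norm ?enorm_ge0//; exact: rA.
Qed.

Lemma closed_le0 (phi : 'rV[R]_m -> R) :
  continuous phi -> closed [set x | phi x <= 0].
Proof. by move=> cphi; apply: (@preimage_closed _ _ phi [set z | z <= 0]) => //; exact: closed_le. Qed.

Lemma bounded_enorm (A : set 'rV[R]_m) r :
  (forall y, A y -> enorm y <= r) -> bounded_set A.
Proof.
move=> Ar; exists r; split; first exact: num_real.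
move=> s rs y /Ar yr; have s0 : 0 <= s by rewrite (le_trans (enorm_ge0 y))// (le_trans yr)// ltW.
rewrite /Num.norm/= mx_normrE; apply: bigmax_le => //= -[i j] _ /=.
by rewrite ord1 (le_trans (coord_le_enorm y j))// (le_trans yr)// ltW.
Qed.

Lemma compact_enorm_ball x r : compact [set y | enorm (y - x) <= r].
Proof.
apply: bounded_closed_compact.
  apply: (@bounded_enorm _ (r + enorm x)) => y /= yr.
  by rewrite -(subrK x y) (le_trans (enormD _ _))// lerD2r.
apply: (@preimage_closed _ _ (fun y => enorm (y - x)) [set z | z <= r] _ (@closed_le R r)) => y _.
exact: continuous_edist.
Qed.

Lemma compact_sphere : compact [set h : 'rV[R]_m | enorm h = 1].
Proof.
apply: bounded_closed_compact; first by apply: (@bounded_enorm _ 1) => y ->.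
apply: (@preimage_closed _ _ (@enorm R m) [set z | z = 1] _ (@closed_eq R 1)) => y _.
exact: continuous_enorm.
Qed.

End Euclid.

(** * Directional derivatives of convex functions *)

Section Convex.
Variables (R : realType) (m : nat).
Implicit Types (u v w x y h k : 'rV[R]_m) (a r s t : R).
Variable phi : 'rV[R]_m -> R.
Hypothesis phi_convex : convex_fun phi.

(** Monotonicity of slopes, cleared of denominators: [x + s *: h] is the convex combination of
    [x + t *: h] and [x] with weight [s / t]. *)
Lemma convex_segment x h s t : 0 <= s -> s <= t -> 0 < t ->
  t * (phi (x + s *: h) - phi x) <= s * (phi (x + t *: h) - phi x).
Proof.
move=> s0 st t0.
have st1 : s / t <= 1 by rewrite ler_pdivrMr ?mul1r.
have := phi_convex (x + t *: h) x (divr_ge0 s0 (ltW t0)) st1.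
have -> : s / t *: (x + t *: h) + (1 - s / t) *: x = x + s *: h.
  rewrite scalerDr scalerA divfK ?gt_eqF// addrAC -scalerDl.
  by rewrite addrCA subrr addr0 scale1r.
rewrite -(ler_pM2l t0) => /le_trans le; rewrite mulrBr lerBlDr (le (_ + _))//.
by rewrite le_eqVlt; apply/orP; left; apply/eqP; field; rewrite gt_eqF.
Qed.

(** Starting the segment at [x - h], with steps [1] and [1 + t], bounds every forward quotient at
    [x] below by a backward one. *)
Lemma convex_opp_slope x h t : 0 < t ->
  t * (phi x - phi (x - h)) <= phi (x + t *: h) - phi x.
Proof.
move=> t0; have t1 : 0 < 1 + t by rewrite ltr_wpDl.
have := @convex_segment (x - h) h 1 (1 + t) ler01 _ t1; rewrite lerDl ltW// => /(_ isT).
rewrite scale1r subrK mul1r scalerDl scale1r addrA subrK; lra.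
Qed.

Let quot x h t := (phi (x + t *: h) - phi x) / t.

Let quot_has_inf x h : has_inf [set quot x h t | t in `]0, +oo[%classic].
Proof.
split; first by exists (quot x h 1); exists 1 => //=; rewrite in_itv/= ltr01.
exists (phi x - phi (x - h)) => _ /= [t + <-]; rewrite in_itv/= andbT => t0.
by rewrite ler_pdivlMr// mulrC convex_opp_slope.
Qed.

(** The quotients are monotone in [t] and bounded below, so the one-sided limit exists and is their
    infimum; all later facts on [dirder] go through this form. *)
Let dirderE x h : dirder phi x h = inf [set quot x h t | t in `]0, +oo[%classic].
Proof.
apply/cvg_lim => //; apply: nondecreasing_at_right_cvgr => //.
  move=> s t; rewrite !in_itv/= !andbT => s0 t0 st.
  rewrite ler_pdivrMr// mulrAC ler_pdivlMr// mulrC [leRHS]mulrC.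
  exact: convex_segment (ltW s0) st t0.
by have [] := quot_has_inf x h.
Qed.

Lemma dirder_le x h t : 0 < t -> t * dirder phi x h <= phi (x + t *: h) - phi x.
Proof.
move=> t0; rewrite mulrC -ler_pdivlMr// dirderE.
by apply: ge_inf; [have [] := quot_has_inf x h|exists t => //=; rewrite in_itv/= t0].
Qed.

Lemma le_dirder x h r :
  (forall t, 0 < t -> t * r <= phi (x + t *: h) - phi x) -> r <= dirder phi x h.
Proof.
move=> H; rewrite dirderE; apply: lb_le_inf; first by have [] := quot_has_inf x h.
by move=> _ /= [t + <-]; rewrite in_itv/= andbT => t0; rewrite ler_pdivlMr// mulrC H.
Qed.

(** An infimum below [r] yields one step [s] with quotient below [r], and monotonicity of slopes
    passes this on to all shorter steps. *)
Lemma dirder_lt x h r : dirder phi x h < r ->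
  exists2 s, 0 < s & forall t, 0 < t -> t <= s -> phi (x + t *: h) - phi x < t * r.
Proof.
rewrite dirderE => /inf_lt[]; first by have [] := quot_has_inf x h.
move=> _ [s /= + <-]; rewrite in_itv/= andbT => s0; rewrite ltr_pdivrMr// => sr.
exists s => // t t0 ts; rewrite -(ltr_pM2l s0).
apply: le_lt_trans (convex_segment x h (ltW t0) ts s0) _.
by rewrite mulrCA ltr_pM2l// mulrC.
Qed.

Lemma dirder0 x : dirder phi x 0 = 0.
Proof.
apply/eqP; rewrite eq_le; apply/andP; split.
  by have := @dirder_le x 0 1 ltr01; rewrite mul1r scaler0 addr0 subrr.
by apply: le_dirder => t _; rewrite mulr0 scaler0 addr0 subrr.
Qed.

Lemma dirderZ_ge x h a : 0 < a -> a * dirder phi x h <= dirder phi x (a *: h).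
Proof.
move=> a0; apply: le_dirder => t t0.
by rewrite mulrA scalerA dirder_le// mulr_gt0.
Qed.

Lemma dirderZ x h a : 0 <= a -> dirder phi x (a *: h) = a * dirder phi x h.
Proof.
rewrite le_eqVlt => /predU1P[<-|a0]; first by rewrite scale0r dirder0 mul0r.
apply/eqP; rewrite eq_le dirderZ_ge// andbT.
have := @dirderZ_ge x (a *: h) a^-1; rewrite invr_gt0 => /(_ a0).
by rewrite scalerA mulVf ?gt_eqF// scale1r mulrC ler_pdivrMr// mulrC.
Qed.

(** [x + (t / 2) *: (h + k)] is the midpoint of [x + t *: h] and [x + t *: k], with [t] short enough
    for both quotients to be within [e / 2] of their limits. *)
Lemma dirderD x h k :
  dirder phi x (h + k) <= dirder phi x h + dirder phi x k.
Proof.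
apply/ler_addgt0Pr => e e0.
have e2 : 0 < e / 2 by lra.
have [s s0 hs] : exists2 s, 0 < s & forall t, 0 < t -> t <= s ->
    phi (x + t *: h) - phi x < t * (dirder phi x h + e / 2).
  by apply: dirder_lt; rewrite ltrDl.
have [s' s'0 ks] : exists2 s, 0 < s & forall t, 0 < t -> t <= s ->
    phi (x + t *: k) - phi x < t * (dirder phi x k + e / 2).
  by apply: dirder_lt; rewrite ltrDl.
pose t := Num.min s s'; have t0 : 0 < t by rewrite lt_min s0.
have := hs _ t0; rewrite ge_min lexx => /(_ isT) ht.
have := ks _ t0; rewrite ge_min lexx orbT => /(_ isT) kt.
have t2 : 0 < t / 2 by lra.
have := dirder_le x (h + k) t2.
have := @phi_convex (x + t *: h) (x + t *: k) (1 / 2).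
have -> : (1 / 2) *: (x + t *: h) + (1 - 1 / 2) *: (x + t *: k) = x + (t / 2) *: (h + k).
  by apply/rowP => j; rewrite !mxE; field.
move=> /(_ _)/(_ _)/le_trans-/(_ _ _ _ (lexx _)) H.
have {}H := H ltac:(lra) ltac:(lra).
move=> D; have {}D := le_trans D (lerB H (lexx _)).
rewrite -(ler_pM2l t2); apply: le_trans D _.
lra.
Qed.

Lemma dirder_convex x : convex_fun (dirder phi x).
Proof.
move=> h k t t0 t1; apply: le_trans (dirderD _ _ _) _.
by rewrite !dirderZ// subr_ge0.
Qed.

(* Halving repeatedly gives a Jensen inequality for arbitrary finite sums without any bookkeeping of the total weight. *)
Lemma convex_sum_dyadic n (u : 'I_n -> 'rV[R]_m) : phi 0 = 0 ->
  phi (\sum_(j < n) u j) <= \sum_(j < n) 2^- j.+1 * phi (2 ^+ j.+1 *: u j).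
Proof.
move=> phi0; elim: n u => [|n IH] u; first by rewrite !big_ord0 phi0.
rewrite !big_ord_recl /=.
have := @phi_convex (2 *: u ord0) (2 *: \sum_(i < n) u (lift ord0 i)) 2^-1.
have h1 : 1 - 2^-1 = 2^-1 :> R by field.
rewrite h1 !scalerA mulVf ?pnatr_eq0// !scale1r => H.
apply: le_trans (H _ _) _; rewrite ?invr_ge0 ?invf_le1 ?ler1n//.
rewrite expr1 lerD2l scaler_sumr.
apply: le_trans (ler_wpM2l _ (IH _)) _; first by rewrite invr_ge0.
rewrite mulr_sumr ler_sum// => i _; rewrite mulrA scalerA -invfM.
by rewrite -exprS -exprSr.
Qed.

End Convex.

(** * Local Lipschitz estimates and continuity of convex functions *)

Section ConvexContinuous.
Variables (R : realType) (m : nat).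
Implicit Types (v x y h : 'rV[R]_m) (C : R).

(** Split [v] into its coordinates and apply the dyadic Jensen inequality. The estimate depends on
    [phi] only through [C], so a family with a common [C] gets a common modulus of continuity. *)
Lemma convex_lipschitz_at (phi : 'rV[R]_m -> R) x C : convex_fun phi -> 0 <= C ->
  (forall j, phi (x + delta_mx 0 j) - phi x <= C) ->
  (forall j, phi (x - delta_mx 0 j) - phi x <= C) ->
  forall v, enorm v <= 2^- m -> `|phi (x + v) - phi x| <= C * (m%:R * enorm v).
Proof.
move=> phi_convex C0 Cp Cn.
pose p v := phi (x + v) - phi x.
have pc : convex_fun p.
  move=> u v t t0 t1; have := phi_convex (x + u) (x + v) t t0 t1.
  have -> : t *: (x + u) + (1 - t) *: (x + v) = x + (t *: u + (1 - t) *: v).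
    by apply/rowP => j; rewrite !mxE; ring.
  rewrite /p; lra.
have p0 : p 0 = 0 by rewrite /p addr0 subrr.
have coord a j : `|a| <= 1 -> p (a *: delta_mx 0 j) <= `|a| * C.
  have seg b w : 0 <= b -> b <= 1 -> p w <= C -> p (b *: w) <= b * C.
    move=> b0 b1 wC; have := convex_segment pc 0 w b0 b1 ltr01.
    rewrite scale1r !add0r p0 !subr0 mul1r => /le_trans; apply.
    by rewrite ler_wpM2l.
  have [a0|a0] := leP 0 a.
    by rewrite ger0_norm// => a1; exact: seg (Cp j).
  rewrite ltr0_norm// => a1.
  rewrite -[a in p (a *: _)]opprK scaleNr -scalerN.
  by apply: seg => //; [rewrite oppr_ge0 ltW|exact: Cn].
have upper v : enorm v <= 2^- m -> p v <= C * (m%:R * enorm v).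
  move=> vm; rewrite [v in p v]row_sum_delta.
  apply: le_trans (convex_sum_dyadic pc _ p0) _.
  have -> : C * (m%:R * enorm v) = \sum_(j < m) C * enorm v.
    by rewrite sumr_const card_ord -mulr_natl; ring.
  apply: ler_sum => j _; rewrite scalerA.
  have j0 : 0 < 2 ^+ j.+1 :> R by rewrite exprn_gt0.
  rewrite -(ler_pM2l j0) mulrA divff ?gt_eqF// mul1r.
  have vj := coord_le_enorm v j.
  (* Since [j.+1 <= m], the radius [2^- m] keeps the coefficient [2 ^+ j.+1 * v 0 j] within [1]. *)
  apply: le_trans (coord _ _ _) _.
    rewrite normrM gtr0_norm// (le_trans (ler_wpM2l (ltW j0) (le_trans vj vm)))//.
    by rewrite ler_pdivrMr ?exprn_gt0// mul1r ler_eXn2l ?ltr1n.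
  by rewrite normrM gtr0_norm// -mulrA ler_pM2l// mulrC ler_wpM2l.
(* For the lower bound: [0] is the midpoint of [v] and [- v], so [p v >= - p (- v)]. *)
move=> v vm; rewrite ler_norml upper// andbT.
have := @upper (- v); rewrite enormN => /(_ vm) H.
have h1 : 1 - 2^-1 = 2^-1 :> R by field.
have := @pc v (- v) 2^-1; rewrite h1 scalerN subrr p0 invr_ge0 invf_le1 ?ler1n//.
move=> /(_ (ler0n _ _) isT) pm; rewrite -/(p v); lra.
Qed.

Lemma convex_continuous (phi : 'rV[R]_m -> R) : convex_fun phi -> continuous phi.
Proof.
move=> phi_convex x.
pose C := \sum_j (`|phi (x + delta_mx 0 j) - phi x| + `|phi (x - delta_mx 0 j) - phi x|).
have CE j : `|phi (x + delta_mx 0 j) - phi x| + `|phi (x - delta_mx 0 j) - phi x| <= C.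
  by rewrite /C (bigD1 j)//= lerDl sumr_ge0.
have C0 : 0 <= C by apply: sumr_ge0 => j _; rewrite addr_ge0.
have lip := @convex_lipschitz_at phi x C phi_convex C0.
have {}lip : forall v, enorm v <= 2^- m -> `|phi (x + v) - phi x| <= C * (m%:R * enorm v).
  apply: lip => j; apply: le_trans (ler_norm _) _; apply: le_trans (CE j).
    by rewrite lerDl.
  by rewrite lerDr.
apply/(@cvgrPdist_lt _ _ _ (nbhs x)) => e e0; apply/nbhs_enormP.
have K0 : 0 < C * m%:R + 1 by rewrite ltr_wpDl ?mulr_ge0.
exists (Num.min (2^- m) (e / (C * m%:R + 1))) => [|y].
  by rewrite lt_min invr_gt0 exprn_gt0// divr_gt0.
rewrite lt_min => /andP[ym ye].
have := lip (y - x) (ltW ym); rewrite (addrC x) subrK distrC => /le_lt_trans; apply.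
rewrite ltr_pdivlMr// in ye.
by have := enorm_ge0 (y - x); lra.
Qed.

End ConvexContinuous.

(** * The minimal slope over the unit sphere *)

Section Mindir.
Variables (R : realType) (m : nat).
Implicit Types (u v w x y h k : 'rV[R]_m) (a r s t : R).
Variable phi : 'rV[R]_m -> R.
Hypothesis phi_convex : convex_fun phi.

(** The directional derivative is convex in the direction, hence continuous, and the sphere is
    compact; the sphere is assumed nonempty because it is empty in dimension [0]. *)
Lemma mindir_attained x :
  (exists h : 'rV[R]_m, enorm h = 1) ->
  exists2 h : 'rV[R]_m, enorm h = 1 & dirder phi x h = mindir phi x.
Proof.
move=> sphere0.
have [h /set_mem /= h1 hmin] := @EVT_min_rV R m (dirder phi x) _ sphere0 (@compact_sphere R m)
  (continuous_subspaceT (convex_continuous (dirder_convex phi_convex x))).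
have lb : lbound [set dirder phi x h | h in [set h : 'rV[R]_m | enorm h = 1]] (dirder phi x h).
  by move=> _ [k /= k1 <-]; apply: hmin; exact: mem_set.
exists h => //; apply/eqP; rewrite eq_le; apply/andP; split.
  by apply: lb_le_inf => //; exists (dirder phi x h); exists h.
by apply: ge_inf; [exists (dirder phi x h)|exists h].
Qed.

Lemma mindir_le x h : enorm h = 1 -> mindir phi x <= dirder phi x h.
Proof.
move=> h1.
have sphere0 : exists h : 'rV[R]_m, enorm h = 1 by exists h.
have [k /set_mem /= k1 kmin] := @EVT_min_rV R m (dirder phi x) _ sphere0 (@compact_sphere R m)
  (continuous_subspaceT (convex_continuous (dirder_convex phi_convex x))).
apply: ge_inf; last by exists h.
by exists (dirder phi x k) => _ [l /= l1 <-]; apply: kmin; exact: mem_set.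
Qed.

Lemma mindir_le_dirder x k : mindir phi x * enorm k <= dirder phi x k.
Proof.
have [->|k0] := eqVneq k 0; first by rewrite enorm0 mulr0 dirder0.
have := mindir_le x (enorm_normalize k0).
rewrite dirderZ ?invr_ge0 ?enorm_ge0// mulrC ler_pdivlMr//.
by rewrite enorm_gt0.
Qed.

Lemma mindir_growth x y : mindir phi x * enorm (y - x) <= phi y - phi x.
Proof.
apply: le_trans (mindir_le_dirder _ _) _.
by have := dirder_le phi_convex x (y - x) ltr01; rewrite mul1r scale1r (addrC x) subrK.
Qed.

(* For a unit minimiser [h] of [phi'(x,.)], the vector [mindir phi x *: h] is a subgradient: compare [phi'(x,.)] at [h] and [h + t *: k] and let [t] go to [0]. *)
Lemma mindir_subgradient x h y : enorm h = 1 -> dirder phi x h = mindir phi x ->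
  mindir phi x * inner h (y - x) <= phi y - phi x.
Proof.
move=> h1 hE; set k := y - x.
suff : mindir phi x * inner h k <= dirder phi x k.
  move=> /le_trans; apply.
  by have := dirder_le phi_convex x k ltr01; rewrite mul1r scale1r (addrC x) subrK.
move: k => {}k; set a := mindir phi x in hE *.
have [a0|a0] := leP 0 a.
  apply: le_trans (mindir_le_dirder _ _); rewrite ler_wpM2l//.
  by rewrite (le_trans (inner_le_enorm _ _))// h1 mul1r.
have key t : 0 < t -> a * inner h k + a * t * enorm k ^+ 2 / 2 <= dirder phi x k.
  move=> t0; rewrite -(ler_pM2l t0).
  have := mindir_le_dirder x (h + t *: k).
  move=> /le_trans/(_ (dirderD phi_convex x h (t *: k))).
  rewrite (dirderZ phi_convex _ _ (ltW t0)) hE -/a => H.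
  (* From [N <= (1 + N ^+ 2) / 2], which removes the square root; the sign of [a] then reverses the
     inequality. *)
  have : enorm (h + t *: k) <= 1 + (t * inner h k + t ^+ 2 * enorm k ^+ 2 / 2).
    have := sqr_ge0 (enorm (h + t *: k) - 1).
    by rewrite sqrrB1 sqr_enormD enormZ innerZr h1 gtr0_norm//; lra.
  by move=> /(ler_wnM2l (ltW a0)); lra.
apply/ler_addgt0Pr => e e0.
have d0 : 0 < - a * enorm k ^+ 2 + 1.
  by rewrite ltr_wpDl// mulr_ge0 ?sqr_ge0// oppr_ge0 ltW.
have := key _ (divr_gt0 e0 d0).
have : - a * enorm k ^+ 2 * (e / (- a * enorm k ^+ 2 + 1)) <= e.
  by rewrite mulrA ler_pdivrMr//; nra.
lra.
Qed.

Lemma mindir_lt x r :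
  (exists h : 'rV[R]_m, enorm h = 1) -> mindir phi x < r ->
  exists h : 'rV[R]_m, enorm h = 1 /\
  exists2 s, 0 < s & forall t, 0 < t -> t <= s -> phi (x + t *: h) - phi x < t * r.
Proof.
move=> /mindir_attained-/(_ x)[h h1 <-] /(dirder_lt phi_convex) H.
by exists h; split.
Qed.

End Mindir.

(** * Maxima of compact families of convex functions *)

Section SupFun.
Variables (R : realType) (m : nat) (I : topologicalType).
Variable G : I -> 'rV[R]_m -> R.
Hypothesis I_compact : compact [set: I].
Hypothesis I_nonempty : [set: I] !=set0.
Hypothesis G_convex : forall i, convex_fun (G i).
Hypothesis G_cont : forall x, continuous (fun i => G i x).
Implicit Types (x y h : 'rV[R]_m).

Lemma supfun_attained x : exists2 i, G i x = supfun G x & forall j, G j x <= supfun G x.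
Proof.
have [i _ imax] := compact_EVT_max I_nonempty I_compact (continuous_subspaceT (@G_cont x)).
have {}imax j : G j x <= G i x by apply: imax; exact: mem_set.
have ub : ubound [set G i x | i in [set: I]] (G i x) by move=> _ [j _ <-].
have E : G i x = supfun G x.
  apply/eqP; rewrite eq_le; apply/andP; split.
    by apply: ub_le_sup; [exists (G i x)|exists i].
  by apply: ge_sup => //; exists (G i x); exists i.
by exists i => // j; rewrite -E.
Qed.

Lemma supfun_ub x i : G i x <= supfun G x.
Proof. by have [] := supfun_attained x. Qed.

Lemma supfun_le x r : (forall i, G i x <= r) -> supfun G x <= r.
Proof. by have [i <-] := supfun_attained x. Qed.

Lemma supfun_convex : convex_fun (supfun G).
Proof.
move=> x y t t0 t1; apply: supfun_le => i.
apply: le_trans (G_convex _ _ _ t0 t1) _.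
by rewrite lerD ?ler_wpM2l ?supfun_ub// subr_ge0.
Qed.

Lemma solsetE : solset G = [set x | supfun G x <= 0].
Proof.
apply/seteqP; split=> x /= H; first exact: supfun_le.
by move=> i; exact: le_trans (supfun_ub x i) H.
Qed.

(** By compactness of [I], the increments towards the finitely many points [x] plus or minus a basis
    vector are bounded uniformly in [i]. This makes the family equi-Lipschitz near [x], and
    continuity in [i] at the fixed [x] does the rest. *)
Lemma convex_joint_continuous : continuous (fun p : I * 'rV[R]_m => G p.1 p.2).
Proof.
have bnd x v : exists2 C, 0 <= C & forall i, G i (x + v) - G i x <= C.
  have c : continuous (fun i => G i (x + v) - G i x).
    by move=> i; apply: continuousB; exact: G_cont.
  have [i _ imax] := compact_EVT_max I_nonempty I_compact (continuous_subspaceT c).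
  exists `|G i (x + v) - G i x| => // j; apply: le_trans (ler_norm _).
  by apply: imax; exact: mem_set.
move=> [i x].
have /choice[Cp /all_and2[Cp0 CpE]] j : exists C : R,
  0 <= C /\ forall i, G i (x + delta_mx 0 j) - G i x <= C.
  by have [C C0 CE] := bnd x (delta_mx 0 j); exists C.
have /choice[Cn /all_and2[Cn0 CnE]] j : exists C : R,
  0 <= C /\ forall i, G i (x - delta_mx 0 j) - G i x <= C.
  by have [C C0 CE] := bnd x (- delta_mx 0 j); exists C.
pose C := \sum_(j < m) (Cp j + Cn j).
have CE j : Cp j + Cn j <= C.
  by rewrite /C (bigD1 j)//= lerDl sumr_ge0// => l _; rewrite addr_ge0.
have C0 : 0 <= C by apply: sumr_ge0 => j _; rewrite addr_ge0.
have lip l : forall v, enorm v <= 2^- m -> `|G l (x + v) - G l x| <= C * (m%:R * enorm v).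
  apply: convex_lipschitz_at => // j.
    by apply: le_trans (CpE j l) (le_trans _ (CE j)); rewrite lerDl.
  by apply: le_trans (CnE j l) (le_trans _ (CE j)); rewrite lerDr.
apply/(@cvgrPdist_lt _ _ _ (nbhs (i, x))) => e e0.
have K0 : 0 < C * m%:R + 1 by rewrite ltr_wpDl ?mulr_ge0.
have e2 : 0 < e / 2 by lra.
pose A := [set l | `|G i x - G l x| < e / 2].
exists (A, [set y | enorm (y - x) < Num.min (2^- m) (e / 2 / (C * m%:R + 1))]) => /=.
  split.
    by have /(@cvgrPdist_lt _ _ _ (nbhs i))/(_ _ e2) := @G_cont x i.
  apply/nbhs_enormP.
  exists (Num.min (2^- m) (e / 2 / (C * m%:R + 1))) => //.
  by rewrite lt_min invr_gt0 exprn_gt0// divr_gt0.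
move=> [l y] [/= Al]; rewrite lt_min => /andP[ym ye].
have := lip l (y - x) (ltW ym); rewrite (addrC x) subrK distrC => H.
rewrite ltr_pdivlMr// in ye.
have -> : G i x - G l y = (G i x - G l x) + (G l x - G l y) by ring.
apply: le_lt_trans (ler_normD _ _) _; move: Al; rewrite /A /=.
by have := enorm_ge0 (y - x); lra.
Qed.

(* Only the indices active at [x] matter for small steps; compactness of [I] makes the step length uniform. *)
Lemma supfun_descent x h s kappa : 0 < s ->
  (forall i, active G x i -> G i (x + s *: h) - G i x < - kappa * s) ->
  exists2 t0, 0 < t0 & forall t, 0 < t -> t <= t0 ->
    supfun G (x + t *: h) <= supfun G x - kappa * t.
Proof.
move=> s0 act.
pose P (t : R) i := G i (x + t *: h) <= supfun G x - kappa * t.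
suff : \forall t \near 0^'+, [set: I] `<=` P t.
  move=> [e /= e0 He]; exists (e / 2); first by lra.
  move=> t t0 te; apply: supfun_le => i; apply: He => //=.
  by rewrite sub0r normrN gtr0_norm//; lra.
have /compact_near_coveringP cov := I_compact.
apply: cov => i _.
pose S := supfun G x.
have seg j t : 0 < t -> t <= s ->
    G j (x + t *: h) <= G j x + t / s * (G j (x + s *: h) - G j x).
  move=> t0 ts; have := convex_segment (G_convex j) x h (ltW t0) ts s0.
  by rewrite -ler_pdivlMl// lerBlDl mulrA [_^-1 * _]mulrC.
have [ai|ai] := pselect (active G x i).
  (* Active index: the strict descent at step [s] persists for nearby [j], and convexity scales it
     down to shorter steps. *)
  exists ([set j | G j (x + s *: h) - G j x < - kappa * s], [set t | 0 < t /\ t <= s]).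
    split => /=.
      have c : continuous (fun i => G i (x + s *: h) - G i x).
        by move=> j; apply: continuousB; exact: G_cont.
      have := act i ai; move: (c i) => /cvgr_lt; exact.
    by exists s => //= t /=; rewrite sub0r normrN => /ltW ts t0; split => //; exact: le_trans (ler_norm _) ts.
  move=> [j t] [/= Hj [t0 ts]]; rewrite /P; apply: le_trans (seg j t t0 ts) _.
  apply: lerD (supfun_ub x j) _.
  have ts0 : 0 < t / s by rewrite divr_gt0.
  apply: le_trans (ler_wpM2l (ltW ts0) (ltW Hj)) _.
  by rewrite mulNr mulrN lerN2 mulrCA divfK ?gt_eqF.
(* Inactive index: half of the gap, [rho], absorbs both the growth of [G j] and the demanded
   decrease [kappa * t] when [t] is short. *)
have gap : G i x < S.
  by rewrite lt_neqAle supfun_ub andbT; apply/eqP => E; exact: ai.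
pose rho := (S - G i x) / 2.
pose B := `|G i (x + s *: h) - G i x| + 1.
have rho0 : 0 < rho by rewrite /rho; lra.
have d0 : 0 < B / s + `|kappa| by rewrite ltr_wpDr// divr_gt0// ltr_wpDl.
exists ([set j | G j (x + s *: h) - G j x < B /\ G j x < S - rho],
        [set t | 0 < t /\ t <= Num.min s (rho / (B / s + `|kappa|))]).
  split => /=.
    apply: filterI.
      have c : continuous (fun i => G i (x + s *: h) - G i x).
        by move=> j; apply: continuousB; exact: G_cont.
      have : G i (x + s *: h) - G i x < B by rewrite (le_lt_trans (ler_norm _))// ltrDl.
      by move: (c i) => /cvgr_lt; exact.
    have : G i x < S - rho by rewrite /rho; lra.
    by move: (@G_cont x i) => /cvgr_lt; exact.
  exists (Num.min s (rho / (B / s + `|kappa|))); first by rewrite /= lt_min s0 divr_gt0.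
  move=> t /=; rewrite sub0r normrN => /ltW ts t0.
  by split => //; exact: le_trans (ler_norm _) ts.
move=> [j t] [/= [HB Hr] [t0]]; rewrite le_min => /andP[ts tr].
rewrite /P; apply: le_trans (seg j t t0 ts) _.
have ts0 : 0 < t / s by rewrite divr_gt0.
apply: le_trans (lerD (ltW Hr) (ler_wpM2l (ltW ts0) (ltW HB))) _.
rewrite ler_pdivlMr// mulrDr in tr.
have -> : t / s * B = t * (B / s) by field; rewrite gt_eqF.
have : kappa * t <= t * `|kappa| by rewrite mulrC; exact: ler_wpM2l (ltW t0) _ _ (ler_norm kappa).
rewrite -/S; lra.
Qed.

End SupFun.

(** * Error bounds from uniform descent, and projections *)

Section ErrorBound.
Variables (R : realType) (m : nat).
Implicit Types (u v w x y z h k p : 'rV[R]_m) (a r s t : R).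

(** At a minimiser [y] of [phi] with [g y > 0], a descent step would lower [g] at rate [kappa] and
    raise the penalty at rate at most [r < kappa]. So [g y <= 0], and [phi y <= phi x] is the
    distance bound. *)
Lemma error_bound (g : 'rV[R]_m -> R) kappa r : continuous g -> 0 < r -> r < kappa ->
  (forall x, 0 < g x -> exists h : 'rV[R]_m, enorm h = 1 /\
    exists2 s, 0 < s & forall t, 0 < t -> t <= s -> g (x + t *: h) <= g x - kappa * t) ->
  forall x, exists2 y, g y <= 0 & r * enorm (x - y) <= Num.max (g x) 0.
Proof.
move=> gc r0 rk descent x.
have [gx|gx] := leP (g x) 0; first by exists x => //; rewrite subrr enorm0 mulr0.
pose phi y := Num.max (g y) 0 + r * enorm (y - x).
have phic : continuous phi.
  move=> y; rewrite /phi; apply: (@continuousD _ _ _ (fun y => Num.max (g y) 0)).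
    by apply: continuous_max; [exact: gc|exact: cst_continuous].
  by apply: continuousM; [exact: cst_continuous|exact: continuous_edist].
have phix : phi x = g x by rewrite /phi subrr enorm0 mulr0 addr0; apply/max_idPl/ltW.
pose ball := [set y | enorm (y - x) <= g x / r].
have ballx : ball x by rewrite /ball /= subrr enorm0 divr_ge0// ltW.
have [y /set_mem /= yball ymin] := @EVT_min_rV R m phi ball (ex_intro _ x ballx)
  (@compact_enorm_ball R m x (g x / r)) (continuous_subspaceT phic).
have yle : phi y <= g x by rewrite -phix; apply: ymin; exact: mem_set.
(* Outside the ball the penalty alone exceeds [g x], so the minimum over the ball is global. *)
have {}ymin z : phi y <= phi z.
  have [zball|zball] := pselect (ball z); first by apply: ymin; exact: mem_set.
  apply: le_trans yle _; rewrite -[leLHS]add0r lerD ?le_max ?lexx ?orbT//.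
  by rewrite mulrC -ler_pdivrMr//; move/negP: zball; rewrite -ltNge => /ltW.
exists y; last first.
  rewrite enormBC (le_trans _ yle)// /phi lerDr le_max lexx orbT//.
rewrite leNgt; apply/negP => gy.
have [h [h1 [s s0 hs]]] := descent y gy.
have /(@cvgr_gt _ _ (nbhs y) _ _ _)/(_ _ gy)/nbhs_enormP[d d0 gd] := gc y.
(* Staying within [d] of [y] keeps [g] positive, so that the truncation at [0] does not
   interfere. *)
pose t := Num.min s (d / 2).
have t0 : 0 < t by rewrite lt_min s0 divr_gt0.
have := ymin (y + t *: h); rewrite /phi (max_idPl (ltW gy)).
have td : t <= d / 2 by rewrite ge_min lexx orbT.
have gyt : 0 < g (y + t *: h).
  by apply: gd; rewrite addrAC subrr add0r enormZ h1 mulr1 gtr0_norm//; lra.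
rewrite (max_idPl (ltW gyt)) => le1.
have le2 : g (y + t *: h) <= g y - kappa * t by apply: hs => //; rewrite ge_min lexx.
have le3 : enorm (y + t *: h - x) <= enorm (y - x) + t.
  by rewrite addrAC (le_trans (enormD _ _))// enormZ h1 mulr1 gtr0_norm.
by have := ler_wpM2l (ltW r0) le3; nra.
Qed.

(** Only the points of [S] no farther from [x] than a known [y0] compete, and they form a compact
    set. *)
Lemma projection_exists (S : set 'rV[R]_m) x : closed S -> S !=set0 ->
  exists2 p, S p & forall y, S y -> enorm (x - p) <= enorm (x - y).
Proof.
move=> Sc [y0 Sy0].
have comp : compact ([set y | enorm (y - x) <= enorm (y0 - x)] `&` S).
  by apply: compact_closedI => //; exact: compact_enorm_ball.
have [p /set_mem[/= px Sp] pmin] := @EVT_min_rV R m (fun y => enorm (y - x)) _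
  (ex_intro _ y0 (conj (lexx _) Sy0)) comp (continuous_subspaceT (@continuous_edist R m x)).
exists p => // y Sy; rewrite !(enormBC x).
have [yy|yy] := leP (enorm (y - x)) (enorm (y0 - x)).
  by apply: pmin; apply: mem_set.
exact: le_trans px (ltW yy).
Qed.

(** * Boundary and growth of the sublevel set *)

Section Sublevel.
Variable f : 'rV[R]_m -> R.
Hypothesis f_convex : convex_fun f.
Let S := [set x | f x <= 0].
Let f_cont : continuous f := convex_continuous f_convex.

Lemma bdry_sublevel_eq0 x : bdry S x -> f x = 0.
Proof.
move=> [/(closed_le0 f_cont) /= fx xint]; apply/eqP; rewrite eq_le fx leNgt.
apply/negP => fx0; apply: xint; rewrite /interior /=.
by move: (@f_cont x) => /cvgr_lt/(_ _ fx0); apply: filterS => y /ltW.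
Qed.

(** Without unit vectors the space is a single point and [A] is open. A boundary point thus rules
    out dimension [0]. *)
Lemma bdry_unit_vector (A : set 'rV[R]_m) x : A x -> bdry A x ->
  exists h : 'rV[R]_m, enorm h = 1.
Proof.
move=> Ax [_ xint]; apply: contrapT => nh; apply: xint.
have E y : y = x.
  apply/eqP; rewrite -subr_eq0; apply/negPn/negP => yx0; apply: nh.
  by eexists; exact: enorm_normalize yx0.
by apply/nbhs_enormP; exists 1 => // y _; rewrite (E y).
Qed.

Lemma bdry_sublevel_unit_vector x : bdry S x -> exists h : 'rV[R]_m, enorm h = 1.
Proof.
by move=> xb; apply: (@bdry_unit_vector S x) => //; rewrite /S /= bdry_sublevel_eq0.
Qed.

(** Take for [p] the projection of [x] on [S]. A nonnegative slope at [p] gives the bound by growth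
    alone. For a negative slope, [x - p] is normal to the cone of descent directions at [p], which
    forces the derivative along [x - p] to be at least the modulus of the slope times the
    distance. *)
Lemma sublevel_growth x : S !=set0 -> 0 < f x ->
  exists p, [/\ bdry S p, 0 < enorm (x - p) & `|mindir f p| * enorm (x - p) <= f x].
Proof.
move=> S0 fx.
have [p Sp pmin] := projection_exists x (closed_le0 f_cont) S0.
have n0 : 0 < enorm (x - p).
  rewrite enorm_gt0 subr_eq0; apply/eqP => xp.
  by move: fx; rewrite xp ltNge; move: Sp => /= ->.
have pb : bdry S p.
  split; first exact: subset_closure.
  (* If [p] were interior, a point of [S] slightly towards [x] would be closer to [x] than [p]. *)
  move=> /nbhs_enormP[r r0 rS].
  pose t := Num.min 1 (r / 2 / enorm (x - p)).
  have t0 : 0 < t by rewrite lt_min ltr01 !divr_gt0.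
  have t1 : t <= 1 by rewrite ge_min lexx.
  have tr : t * enorm (x - p) < r.
    have : t <= r / 2 / enorm (x - p) by rewrite ge_min lexx orbT.
    by rewrite ler_pdivlMr//; lra.
  have /pmin : S (p + t *: (x - p)).
    by apply: rS; rewrite addrAC subrr add0r enormZ gtr0_norm.
  have -> : x - (p + t *: (x - p)) = (1 - t) *: (x - p).
    by apply/rowP => j; rewrite !mxE; ring.
  rewrite enormZ ger0_norm ?subr_ge0// => le_self.
  have tn := mulr_gt0 t0 n0; lra.
exists p; split => //; have fp := bdry_sublevel_eq0 pb.
have [a0|a0] := leP 0 (mindir f p).
  by rewrite ger0_norm//; have := mindir_growth f_convex p x; rewrite fp subr0.
have [h h1 hE] := mindir_attained f_convex p (bdry_sublevel_unit_vector pb).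
have := dirder_le f_convex p (x - p) ltr01.
rewrite mul1r scale1r (addrC p) subrK fp subr0; apply: le_trans.
set n := x - p in n0 *; set a := mindir f p in a0 hE *.
(* Small steps along a descent direction stay in [S], so they cannot approach [x]; expand the square
   of [n - t *: k] and let [t] be small. *)
have normal k : dirder f p k < 0 -> inner n k <= 0.
  move=> /(dirder_lt f_convex)[s s0 hs].
  have key t : 0 < t -> t <= s -> 2 * inner n k <= t * enorm k ^+ 2.
    move=> t0 ts; have := hs t t0 ts; rewrite fp subr0 mulr0 => /ltW/pmin.
    have -> : x - (p + t *: k) = n - t *: k by rewrite /n opprD addrA.
    rewrite -/n -ler_sqr ?nnegrE ?enorm_ge0// (sqr_enormD n) innerNr innerZr enormN enormZ.
    by rewrite gtr0_norm// => le_n; rewrite -(ler_pM2l t0); lra.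
  rewrite leNgt; apply/negP => nk.
  have d0 : 0 < enorm k ^+ 2 + 1 by rewrite ltr_wpDl ?sqr_ge0.
  have q0 : 0 < inner n k / (enorm k ^+ 2 + 1) by rewrite divr_gt0.
  have t0 : 0 < Num.min s (inner n k / (enorm k ^+ 2 + 1)) by rewrite lt_min s0.
  have := key _ t0; rewrite ge_min lexx => /(_ isT).
  have : Num.min s (inner n k / (enorm k ^+ 2 + 1)) <= inner n k / (enorm k ^+ 2 + 1).
    by rewrite ge_min lexx orbT.
  move=> /(ler_wpM2r (sqr_ge0 (enorm k))) H /le_trans/(_ H).
  rewrite mulrAC ler_pdivlMr//; have := sqr_ge0 (enorm k); nra.
rewrite (ltr0_norm a0) leNgt; apply/negP => small.
(* [h + sigma *: n] is still a descent direction, but it leaves the half-space [inner n _ <= 0]. *)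
have [sigma [sg0 sg1 sg2]] : exists sigma,
    [/\ 0 < sigma, 1 < sigma * enorm n & sigma * dirder f p n < - a].
  have [b0|b0] := leP (dirder f p n) 0.
    exists (2 / enorm n); split; first by rewrite divr_gt0.
      by rewrite divfK ?gt_eqF// ltr1n.
    apply: le_lt_trans (_ : 0 < _); last by rewrite oppr_gt0.
    by rewrite mulr_ge0_le0// divr_ge0// ltW.
  (* [small] leaves a nonempty interval of admissible [sigma], whose midpoint is taken. *)
  have lt1 : (enorm n)^-1 < - a / dirder f p n.
    by rewrite -[_^-1]mul1r ltr_pdivrMr// mulrAC ltr_pdivlMr// mul1r.
  exists (((enorm n)^-1 + - a / dirder f p n) / 2); split.
  - by rewrite divr_gt0// addr_gt0 ?invr_gt0// divr_gt0// oppr_gt0.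
  - rewrite -ltr_pdivrMr// mul1r; lra.
  - rewrite -ltr_pdivlMr//; lra.
have : dirder f p (h + sigma *: n) < 0.
  apply: le_lt_trans (dirderD f_convex _ _ _) _.
  by rewrite (dirderZ f_convex _ _ (ltW sg0)) hE; lra.
move=> /normal; rewrite innerDr innerZr -sqr_enorm.
have := inner_le_enorm (- n) h; rewrite enormN h1 mulr1 innerNl.
nra.
Qed.

End Sublevel.

(** * Upper and lower estimates for the error bound modulus *)

Section TauMin.
Variables (I : Type) (G : I -> 'rV[R]_m -> R).

Lemma tau_min_le c : 0 < c ->
  (forall x, exists2 y, solset G y & enorm (x - y) <= c * Num.max (supfun G x) 0) ->
  (tau_min G <= c%:E)%E.
Proof.
move=> c0 H; apply: ereal_inf_lbound; exists c => //; split => // x.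
have [y Gy yx] := H x.
by apply: ge_ereal_inf; exists (enorm (x - y))%:E; [exists y|rewrite lee_fin].
Qed.

(** The infimum is not assumed attained, so an admissible [tau] below [c + e / (M + 1)] is used; the
    added [1] covers [M = 0]. *)
Lemma tau_min_ge_dist c x r : (tau_min G <= c%:E)%E ->
  (forall y, solset G y -> r <= enorm (x - y)) -> r <= c * Num.max (supfun G x) 0.
Proof.
move=> tc xr; set M := Num.max _ _.
have M0 : 0 <= M by rewrite le_max lexx orbT.
apply/ler_addgt0Pr => e e0.
have M1 : 0 < M + 1 by rewrite ltr_wpDl.
have : (tau_min G < (c + e / (M + 1))%:E)%E.
  by rewrite (le_lt_trans tc)// lte_fin ltrDl divr_gt0.
move=> /ereal_inf_lt[_ [tau [tau0 tauH] <-]]; rewrite lte_fin => tc'.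
have : (r%:E <= (tau * M)%:E)%E.
  apply: le_trans (tauH x); apply/ereal_infP => _ [y Gy <-].
  by rewrite lee_fin xr.
rewrite lee_fin => /le_trans; apply.
apply: le_trans (ler_wpM2r M0 (ltW tc')) _.
rewrite mulrDl lerD2l mulrAC ler_pdivrMr// ler_wpM2l//; lra.
Qed.

End TauMin.
End ErrorBound.

(** * Comparison of lower limits with constants *)

Lemma limn_einf_le (R : realType) (u : nat -> \bar R) (l : \bar R) :
  (forall k, (u k <= l)%E) -> (limn_einf u <= l)%E.
Proof.
move=> ul; rewrite limn_einf_lim; apply: lime_le; first exact: is_cvg_einfs.
apply: nearW => n; apply: le_trans (ul n).
by apply: ereal_inf_lbound; exists n => /=.
Qed.

Lemma limn_einf_ge (R : realType) (u : nat -> \bar R) (l : \bar R) :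
  (\forall k \near \oo, (l <= u k)%E) -> (l <= limn_einf u)%E.
Proof.
move=> [N _ ul]; rewrite limn_einf_lim; apply: lime_ge; first exact: is_cvg_einfs.
exists N => // n /= Nn; apply/ereal_infP => _ [k /= nk <-].
by apply: ul => /=; exact: leq_trans nk.
Qed.

(** * The three implications *)

Section Equivalence.
Variables (R : realType) (m : nat) (I : topologicalType).
Variable F : I -> 'rV[R]_m -> R.
Hypothesis I_compact : compact [set: I].
Hypothesis I_nonempty : [set: I] !=set0.
Hypothesis F_convex : forall i, convex_fun (F i).
Hypothesis F_cont : forall x, continuous (fun i => F i x).
Implicit Types (u v w x y z h xb : 'rV[R]_m).

Let f := supfun F.
Let S := [set x | f x <= 0].
Let f_convex : convex_fun f := supfun_convex I_compact I_nonempty F_convex F_cont.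

Let stable_at (eps : R) (G : I -> 'rV[R]_m -> R) := [/\
  continuous (fun p : I * 'rV[R]_m => G p.1 p.2),
  forall i, convex_fun (G i),
  exists z, bdry S z /\ forall i, F i z = G i z,
  (ereal_sup [set Lip (fun x => (F i x - G i x)%R) | i in [set: I]] < eps%:E)%E &
  forall x, (mindir f x < 0 -> active G x `<=` active F x) /\
            (0 < mindir f x -> active F x `<=` active G x)].

Let QC (tau : R) := forall (z x : nat -> 'rV[R]_m),
  (forall k, (S `\` bdry S) (z k)) -> (forall k, bdry S (x k)) ->
  (fun k => (f (z k) - f (x k)) / enorm (z k - x k)) @ \oo --> (0 : R) ->
  (tau%:E < limn_einf (fun k => (`|mindir f (z k)|)%:E))%E.

Let tilt (eps : R) u xb i x := F i x + eps * inner u (x - xb).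

Lemma enorm_bdry_gt0 (A : set 'rV[R]_m) z x : (A `\` bdry A) z -> bdry A x -> 0 < enorm (z - x).
Proof.
move=> [_ zb] xb; rewrite enorm_gt0 subr_eq0; apply/eqP => zx.
by apply: zb; rewrite zx.
Qed.

(** Violators for [eps = 1 / (k + 1)] would form sequences whose quotients lie between
    [- 1 / (k + 1)] and [0], while the slopes stay at most [tau], against the qualification
    condition. *)
Lemma QC_uniform tau : QC tau -> exists2 eps, 0 < eps & forall z x,
  (S `\` bdry S) z -> bdry S x -> - eps * enorm (z - x) <= f z -> tau < `|mindir f z|.
Proof.
move=> qc; apply: contrapT => neg.
have /choice[w wP] k : exists p : 'rV[R]_m * 'rV[R]_m, [/\ (S `\` bdry S) p.1, bdry S p.2,
    - k.+1%:R^-1 * enorm (p.1 - p.2) <= f p.1 & `|mindir f p.1| <= tau].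
  apply: contrapT => nk; apply: neg; exists k.+1%:R^-1; first by rewrite invr_gt0.
  move=> z x zS xb zx; rewrite ltNge; apply/negP => zt.
  by apply: nk; exists (z, x).
have := qc (fun k => (w k).1) (fun k => (w k).2).
have h1 k : (S `\` bdry S) (w k).1 by have [] := wP k.
have h2 k : bdry S (w k).2 by have [] := wP k.
move=> /(_ h1 h2); apply/not_implyP; split; last first.
  apply/negP; rewrite -leNgt; apply: limn_einf_le => k.
  by rewrite lee_fin; have [] := wP k.
have lower : (fun k => - k.+1%:R^-1 : R) @ \oo --> (0 : R).
  by rewrite -[0]oppr0; apply: cvgN; exact: cvg_harmonic.
apply: (squeeze_cvgr _ lower (cvg_cst 0)); apply: nearW => k.
have [[zS zb] xb zx _] := wP k.
have d0 := enorm_bdry_gt0 (h1 k) (h2 k).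
rewrite (bdry_sublevel_eq0 f_convex xb) subr0 (ler_pdivlMr _ _ d0) zx andTb.
by rewrite (ler_pdivrMr _ _ d0) mul0r; exact: zS.
Qed.

Lemma Lip_diff_le eps G : (ereal_sup [set Lip (fun x => (F i x - G i x)%R) | i in [set: I]] < eps%:E)%E ->
  forall i x y, `|(F i x - G i x) - (F i y - G i y)| <= eps * enorm (x - y).
Proof.
move=> lt_eps i x y; have [->|xy] := eqVneq x y; first by rewrite !subrr normr0 enorm0 mulr0.
have d0 : 0 < enorm (x - y) by rewrite enorm_gt0 subr_eq0.
rewrite -ler_pdivrMr// -lee_fin; apply: le_trans (ltW lt_eps).
apply: (@le_trans _ _ (Lip (fun x => (F i x - G i x)%R))).
  by apply: ereal_sup_ubound; exists x, y.
by apply: ereal_sup_ubound; exists i.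
Qed.

(** Along a steep direction [f] drops at a rate above [kappa + eps]. An index active for [G] is
    active for [F], so [F i] drops at least as much as [f], and the perturbation costs [G i] at most
    [eps] of that rate. *)
Lemma descent_transfer tau eps kappa G x : kappa + eps < tau ->
  (forall i, convex_fun (G i)) -> (forall x, continuous (fun i => G i x)) ->
  (forall i x y, `|(F i x - G i x) - (F i y - G i y)| <= eps * enorm (x - y)) ->
  (exists h : 'rV[R]_m, enorm h = 1) ->
  mindir f x <= - tau -> active G x `<=` active F x ->
  exists h : 'rV[R]_m, enorm h = 1 /\ exists2 s, 0 < s & forall t, 0 < t -> t <= s ->
    supfun G (x + t *: h) <= supfun G x - kappa * t.
Proof.
move=> ket G_convex G_cont Glip sphere0 mt act.
have [|h [h1 [s s0 hs]]] := @mindir_lt _ _ f f_convex x (- kappa - eps) sphere0.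
  by apply: le_lt_trans mt _; lra.
exists h; split => //.
apply: (supfun_descent I_compact I_nonempty G_convex G_cont s0) => i Gi.
have := hs s s0 (lexx s); have := act i Gi; rewrite /active /= -/f => <-.
have := supfun_ub I_compact I_nonempty F_cont (x + s *: h) i; rewrite -/f.
have := Glip i (x + s *: h) x.
rewrite (addrAC x) subrr add0r enormZ h1 (gtr0_norm s0) ler_norml.
move=> /andP[]; lra.
Qed.

Lemma stability_of_slopes tau : 0 < tau ->
  (forall xb, bdry S xb -> tau < `|mindir f xb|) -> QC tau ->
  exists c eps, 0 < c /\ 0 < eps /\
    forall G, stable_at eps G -> (tau_min G <= c%:E)%E.
Proof.
move=> tau0 bdry_slope /QC_uniform[e0 e0_gt0 int_slope].
(* With [eps <= tau / 4] the perturbed function still descends at rate [tau / 2]; the error bound is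
   taken at the smaller rate [tau / 4], whence the constant [c]. *)
pose eps := Num.min e0 (tau / 4).
have eps0 : 0 < eps by rewrite lt_min e0_gt0 divr_gt0.
have eps_tau : eps <= tau / 4 by rewrite ge_min lexx orbT.
have eps_e0 : eps <= e0 by rewrite ge_min lexx.
exists (tau / 4)^-1, eps; split; first by rewrite invr_gt0 divr_gt0.
split=> // G [G_joint G_convex [z [zb FGz]] /Lip_diff_le G_lip act].
have G_cont x : continuous (fun i => G i x).
  move=> i; apply: (@continuous_comp _ _ _ (fun i => (i, x)) (fun p => G p.1 p.2)); last exact: G_joint.
  move=> A [[B C] [/= Bi Cx] BC]; apply: filterS Bi => j Bj; apply: BC.
  by split => //=; exact: nbhs_singleton Cx.
have g_convex := supfun_convex I_compact I_nonempty G_convex G_cont.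
have fz : f z = 0 := bdry_sublevel_eq0 f_convex zb.
have sphere0 := bdry_sublevel_unit_vector f_convex zb.
have steep x : 0 < supfun G x -> mindir f x <= - tau.
  move=> gx.
  have near_f : supfun G x <= f x + eps * enorm (x - z).
    apply: (supfun_le I_compact I_nonempty G_cont) => i.
    have := G_lip i x z; rewrite FGz subrr subr0 ler_norml => /andP[+ _].
    have := supfun_ub I_compact I_nonempty F_cont x i; rewrite -/f; lra.
  have xz : 0 < enorm (x - z).
    rewrite enorm_gt0 subr_eq0; apply/eqP => xz.
    by move: near_f; rewrite xz subrr enorm0 mulr0 addr0 fz leNgt -xz gx.
  have [fx|fx] := ltP 0 (f x).
    have S0 : S !=set0 by exists z; rewrite /S /= fz.
    (* On the way from [x] to [p] the value falls from at least [tau * enorm (x - p)] to [0], so the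
       slope at [x] is at most [- tau]. *)
    have [p [pb xp pf]] := sublevel_growth f_convex S0 fx.
    have := mindir_growth f_convex x p; rewrite (bdry_sublevel_eq0 f_convex pb) enormBC => grow.
    have slope := ler_wpM2r (ltW xp) (ltW (bdry_slope p pb)).
    by rewrite -(ler_pM2r xp); lra.
  have slope : tau < `|mindir f x|.
    have [xb|xb] := pselect (bdry S x); first exact: bdry_slope.
    apply: (int_slope x z _ zb); first by split.
    have := ler_wpM2r (ltW xz) eps_e0; lra.
  (* A slope above [tau] would raise [f] between [x] and [z] by more than [eps * enorm (x - z)],
     against [near_f]. *)
  have [a0|a0] := leP 0 (mindir f x); last by move: slope; rewrite ltr0_norm//; lra.
  have := mindir_growth f_convex x z; rewrite fz enormBC.
  move: slope; rewrite ger0_norm// => slope; nra.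
apply: tau_min_le; first by rewrite invr_gt0 divr_gt0.
rewrite (solsetE I_compact I_nonempty G_cont) => x.
suff [y gy yx] : exists2 y, supfun G y <= 0 &
    tau / 4 * enorm (x - y) <= Num.max (supfun G x) 0.
  by exists y => //; rewrite mulrC ler_pdivlMr ?divr_gt0// mulrC.
apply: (@error_bound _ _ _ (tau / 2)); first exact: convex_continuous.
- by rewrite divr_gt0.
- lra.
move=> {}x gx; apply: (@descent_transfer tau eps) => //; first lra.
  exact: steep.
by have [H _] := act x; apply: H; have := steep x gx; lra.
Qed.

Lemma tilt_supfun eps u xb x : supfun (tilt eps u xb) x = f x + eps * inner u (x - xb).
Proof.
have [i Fi Fle] := supfun_attained I_compact I_nonempty F_cont x.
have ub : ubound [set tilt eps u xb j x | j in [set: I]] (f x + eps * inner u (x - xb)).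
  by move=> _ [j _ <-]; rewrite lerD2r Fle.
apply/eqP; rewrite eq_le; apply/andP; split.
  by apply: ge_sup => //; exists (tilt eps u xb i x); exists i.
apply: ub_le_sup; first by exists (f x + eps * inner u (x - xb)).
by exists i => //; rewrite /tilt Fi.
Qed.

Lemma tilt_convex eps u xb i : convex_fun (tilt eps u xb i).
Proof.
move=> x y t t0 t1; have := F_convex i x y t0 t1; rewrite /tilt.
have -> : t *: x + (1 - t) *: y - xb = t *: (x - xb) + (1 - t) *: (y - xb).
  by apply/rowP => j; rewrite !mxE; ring.
rewrite (innerDr (t *: _)) !innerZr; lra.
Qed.

(** Halving [eps] makes the Lipschitz bound strict. The tilt vanishes at [xb] and is common to all
    indices. *)
Lemma tilt_stable eps u xb : 0 < eps -> bdry S xb -> enorm u <= 1 ->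
  stable_at eps (tilt (eps / 2) u xb).
Proof.
move=> eps0 xbb u1; split.
- apply: (convex_joint_continuous I_compact I_nonempty (tilt_convex _ _ _)) => x i.
  by apply: (@continuousD _ _ _ (fun i => F i x)); [exact: F_cont|exact: cst_continuous].
- exact: tilt_convex.
- exists xb; split => // i.
  by rewrite /tilt subrr -(scale0r xb) innerZr mul0r mulr0 addr0.
- apply: (@le_lt_trans _ _ (eps / 2)%:E); last by rewrite lte_fin; lra.
  apply/ereal_supP => _ [i _ <-]; apply/ereal_supP => _ [x [y [xy ->]]].
  have d0 : 0 < enorm (x - y) by rewrite enorm_gt0 subr_eq0.
  rewrite lee_fin ler_pdivrMr// /tilt.
  have -> : F i x - (F i x + eps / 2 * inner u (x - xb)) -
      (F i y - (F i y + eps / 2 * inner u (y - xb))) =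
      eps / 2 * (inner u (y - xb) - inner u (x - xb)) by ring.
  rewrite -innerNr -innerDr opprB addrA subrK normrM gtr0_norm ?divr_gt0//.
  rewrite ler_pM2l ?divr_gt0// enormBC (le_trans (normr_inner_le _ _))//.
  by rewrite ler_piMl ?enorm_ge0.
- have E x : active (tilt (eps / 2) u xb) x = active F x.
    apply/seteqP; split=> i; rewrite /active /= tilt_supfun /tilt.
      exact: addIr.
    by move=> ->.
  by move=> x; rewrite E; split=> _ i.
Qed.

(** Rescales the hypothesis to an arbitrary tilt [v] of norm at most [eps], in the form used for
    contradictions: a point far from the tilted sublevel set must have a large tilted value. *)
Lemma tau_min_tilt eps c v xb x r : 0 < eps -> bdry S xb -> enorm v <= eps ->
  (forall xb u, bdry S xb -> enorm u <= 1 -> (tau_min (tilt eps u xb) <= c%:E)%E) ->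
  (forall y, f y + inner v (y - xb) <= 0 -> r <= enorm (x - y)) ->
  r <= c * Num.max (f x + inner v (x - xb)) 0.
Proof.
move=> eps0 xbb veps H dist.
have u1 : enorm (eps^-1 *: v) <= 1.
  by rewrite enormZ gtr0_norm ?invr_gt0// mulrC ler_pdivrMr// mul1r.
have E y : eps * inner (eps^-1 *: v) (y - xb) = inner v (y - xb).
  by rewrite innerZl mulrA divff ?gt_eqF// mul1r.
have := tau_min_ge_dist (x := x) (r := r) (H xb _ xbb u1).
rewrite tilt_supfun E; apply => y Gy; apply: dist.
have [i Fi _] := supfun_attained I_compact I_nonempty F_cont y.
by have := Gy i; rewrite /tilt E Fi.
Qed.

Lemma slopes_of_tilt_stability c eps : 0 < c -> 0 < eps ->
  (forall xb u, bdry S xb -> enorm u <= 1 -> (tau_min (tilt eps u xb) <= c%:E)%E) ->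
  exists tau, [/\ 0 < tau, (tau%:E < ereal_inf [set (`|mindir f xb|)%:E | xb in bdry S])%E
    & QC tau].
Proof.
move=> c0 eps0 H.
(* The first bound admits tilts of norm up to [3 * kappa]. The second gives
   [c * (2 * kappa) <= 1 / 2], so that each error bound below would make a positive number at most
   half of itself. *)
pose kappa := Num.min (eps / 4) (1 / (4 * c)).
have k0 : 0 < kappa by rewrite lt_min !divr_gt0// mulr_gt0.
have k_eps : kappa <= eps / 4 by rewrite ge_min lexx.
have kc : c * kappa <= 1 / 4.
  have : kappa <= 1 / (4 * c) by rewrite ge_min lexx orbT.
  by rewrite ler_pdivlMr ?mulr_gt0//; lra.
(* Tilting so that [f'(xb,h)] becomes [kappa] along the minimiser [h] keeps [S_G] behind the hyperplane through [xb] orthogonal to [h]. *)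
have bdry_slope xb : bdry S xb -> kappa <= `|mindir f xb|.
  move=> xbb; rewrite leNgt ltr_norml; apply/negP => /andP[a_lo a_hi].
  have [h h1 hE] := mindir_attained f_convex xb (bdry_sublevel_unit_vector f_convex xbb).
  have fxb := bdry_sublevel_eq0 f_convex xbb.
  set a := mindir f xb in a_lo a_hi hE.
  have [s s0 /(_ s s0 (lexx s))] : exists2 s, 0 < s & forall t, 0 < t -> t <= s ->
      f (xb + t *: h) - f xb < t * (a + kappa).
    by apply: (dirder_lt f_convex); rewrite hE; lra.
  rewrite fxb subr0 => fs.
  have vn : enorm ((kappa - a) *: h) <= eps by rewrite enormZ h1 gtr0_norm; lra.
  have := @tau_min_tilt eps c ((kappa - a) *: h) xb (xb + s *: h) s eps0 xbb vn H.
  rewrite addrAC subrr add0r innerZl innerZr -sqr_enorm h1 => B.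
  (* The point [xb + s *: h] is at distance [s] from the hyperplane, while its tilted value is below
     [2 * kappa * s]. *)
  have : s <= c * (2 * kappa * s).
    apply: le_trans (B _) _ => [y|].
      rewrite innerZl => gy; have := mindir_subgradient f_convex y h1 hE.
      rewrite fxb subr0 -/a => fy.
      have hy : inner h (y - xb) <= 0 by rewrite -(pmulr_rle0 _ k0); lra.
      have := inner_le_enorm h (xb + s *: h - y); rewrite h1 mul1r; apply: le_trans.
      rewrite addrAC innerDr innerZr -sqr_enorm h1 -(opprB y xb) innerNr; lra.
    rewrite ler_pM2l// ge_max; apply/andP; split; first by lra.
    by rewrite !mulr_ge0// ltW.
  by have := ler_wpM2r (ltW s0) kc; lra.
(* Same idea with a tilt along [z - x] that makes [g z] positive. *)
have int_slope z x : (S `\` bdry S) z -> bdry S x ->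
    `|(f z - f x) / enorm (z - x)| < kappa -> kappa <= `|mindir f z|.
  move=> zS xb q; rewrite leNgt; apply/negP => a_small.
  have d0 := enorm_bdry_gt0 zS xb.
  have fx := bdry_sublevel_eq0 f_convex xb.
  have [h h1 hE] := mindir_attained f_convex z (bdry_sublevel_unit_vector f_convex xb).
  set a := mindir f z in a_small hE.
  have fz : - kappa * enorm (z - x) < f z.
    move: q; rewrite fx subr0 ltr_norml => /andP[+ _].
    by rewrite ltr_pdivlMr.
  set d := enorm (z - x) in d0 fz.
  pose n := d^-1 *: (z - x).
  have n1 : enorm n = 1 by apply: enorm_normalize; rewrite -enorm_gt0.
  have nz : inner n (z - x) = d.
    by rewrite innerZl -sqr_enorm -/d expr2 mulrA mulVf ?gt_eqF// mul1r.
  clearbody n; pose v := - a *: h + (2 * kappa) *: n.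
  have vn : enorm v <= eps.
    apply: le_trans (enormD _ _) _; rewrite !enormZ h1 n1 normrN.
    rewrite (gtr0_norm (mulr_gt0 _ k0))//; lra.
  (* The part [2 * kappa * d] from [n] outweighs [f z > - kappa * d] together with a loss of at most
     [kappa * d] from [- a *: h]. *)
  have gz : 0 < f z + inner v (z - x).
    rewrite innerDl !innerZl nz.
    have ah : a * inner h (z - x) <= kappa * d.
      apply: le_trans (ler_norm _) _; rewrite normrM ler_pM//; first exact: ltW.
      by have := normr_inner_le h (z - x); rewrite h1 mul1r.
    lra.
  have := @tau_min_tilt eps c v x z ((f z + inner v (z - x)) / (2 * kappa)) eps0 xb vn H.
  rewrite (max_idPl (ltW gz)) => B.
  (* The part [- a *: h] cancels the subgradient at [z], leaving [2 * kappa] times the unit vector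
     [n] as subgradient of the tilted function there. *)
  have : (f z + inner v (z - x)) / (2 * kappa) <= c * (f z + inner v (z - x)).
    apply: B => y gy; rewrite ler_pdivrMr ?mulr_gt0//.
    have fy := mindir_subgradient f_convex y h1 hE; rewrite -/a in fy.
    have ny : inner n (z - y) <= enorm (z - y).
      by have := inner_le_enorm n (z - y); rewrite n1 mul1r.
    have -> : inner v (z - x) = inner v (y - x) + inner v (z - y).
      by rewrite -innerDr [RHS](_ : _ = inner v (z - x))// addrC addrA subrK.
    have -> : inner v (z - y) = a * inner h (y - z) + 2 * kappa * inner n (z - y).
      by rewrite /v innerDl !innerZl -(opprB z y) innerNr; ring.
    have := ler_wpM2l (ltW k0) ny; lra.
  rewrite ler_pdivrMr ?mulr_gt0//.
  by have := ler_wpM2r (ltW gz) kc; lra.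
(* Halving [kappa] turns the weak bounds on the slopes into the strict ones required. *)
exists (kappa / 2); split; first by lra.
  apply: (@lt_le_trans _ _ kappa%:E); first by rewrite lte_fin; lra.
  by apply/ereal_infP => _ [xb xbb <-]; rewrite lee_fin bdry_slope.
move=> z x zS xb /(@cvgrPdist_lt _ _ _ (nbhs \oo))/(_ _ k0) q.
apply: (@lt_le_trans _ _ kappa%:E); first by rewrite lte_fin; lra.
apply: limn_einf_ge; apply: filterS q => k; rewrite sub0r normrN lee_fin.
exact: int_slope.
Qed.

End Equivalence.

Theorem theorem14 (R : realType) (m : nat) (I : topologicalType)
  (F : I -> 'rV[R]_m -> R)
  (I_compact : compact [set: I]) (I_hausdorff : hausdorff_space I)
  (I_nonempty : [set: I] !=set0)
  (F_convex : forall i, convex_fun (F i))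
  (F_cont : forall x, continuous (fun i => F i x)) :
  let f := supfun F in
  let Sf := [set x | f x <= 0] in
  let cond_i :=
    exists tau : R, 0 < tau /\
      (tau%:E < ereal_inf [set (`|mindir f xb|)%:E | xb in bdry Sf])%E /\
      (forall (z x : nat -> 'rV[R]_m),
         (forall k, (Sf `\` bdry Sf) (z k)) ->
         (forall k, bdry Sf (x k)) ->
         (fun k => (f (z k) - f (x k)) / enorm (z k - x k)) @ \oo --> (0 : R) ->
         (tau%:E < limn_einf (fun k => (`|mindir f (z k)|)%:E))%E) in
  let cond_ii :=
    exists c eps : R, 0 < c /\ 0 < eps /\
      forall G : I -> 'rV[R]_m -> R,
        continuous (fun p : I * 'rV[R]_m => G p.1 p.2) ->
        (forall i, convex_fun (G i)) ->
        (exists z, bdry Sf z /\ forall i, F i z = G i z) ->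
        (ereal_sup [set Lip (fun x => (F i x - G i x)%R) | i in [set: I]] < eps%:E)%E ->
        (forall x, (mindir f x < 0 -> active G x `<=` active F x) /\
                   (0 < mindir f x -> active F x `<=` active G x)) ->
        (tau_min G <= c%:E)%E in
  let cond_iii :=
    exists c eps : R, 0 < c /\ 0 < eps /\
      forall (xb u : 'rV[R]_m), bdry Sf xb -> enorm u <= 1 ->
        (tau_min (fun i x => (F i x + eps * inner u (x - xb))%R) <= c%:E)%E in
  (cond_i <-> cond_ii) /\ (cond_i <-> cond_iii).
Proof.
move=> f Sf cond_i cond_ii cond_iii.
have i_ii : cond_i -> cond_ii.
  move=> [tau [tau0 [bdry_slope qc]]].
  have [] := stability_of_slopes I_compact I_nonempty F_convex F_cont tau0 _ qc.
    move=> xb xbb; rewrite -lte_fin; apply: lt_le_trans bdry_slope _.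
    by apply: ereal_inf_lbound; exists xb.
  move=> c [eps [c0 [eps0 H]]]; exists c, eps; do 2!split => //.
  by move=> G G1 G2 G3 G4 G5; apply: H; split.
have ii_iii : cond_ii -> cond_iii.
  move=> [c [eps [c0 [eps0 H]]]]; exists c, (eps / 2); do 2!split => //.
    by rewrite divr_gt0.
  move=> xb u xbb u1.
  have [G1 G2 G3 G4 G5] := tilt_stable I_compact I_nonempty F_convex F_cont eps0 xbb u1.
  exact: H.
have iii_i : cond_iii -> cond_i.
  move=> [c [eps [c0 [eps0 H]]]].
  have [tau [tau0 bdry_slope qc]] :=
    slopes_of_tilt_stability I_compact I_nonempty F_convex F_cont c0 eps0 H.
  by exists tau.
split; split.
- exact: i_ii.
- by move=> /ii_iii/iii_i.
- by move=> /i_ii/ii_iii.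
- exact: iii_i.
Qed.
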